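(* Let $(M,J,g)$ be a $(J^2=\pm1)$-metric manifold, i.e. a manifold with an $(\alpha,\varepsilon)$-structure $(J,g)$, satisfying $\alpha\varepsilon=1$. If the Levi Civita connection $\nabla^{\mathrm g}$ of $g$ and the tensor field $J$ satisfy $$(\nabla^{\mathrm g}_XJ)Y+(\nabla^{\mathrm g}_YJ)X=0,\quad\forall X,Y\in\mathfrak{X}(M),$$ then $(M,J,g)$ is a Kähler type manifold, i.e. $\nabla^{\mathrm g}J=0$.
   Context: $M$ is a smooth manifold, $\mathfrak{X}(M)$ is the set of vector fields on $M$, and $Id$ is the identity tensor field. For $\alpha,\varepsilon\in\{-1,1\}$, an $(\alpha,\varepsilon)$-structure on $M$ is a pair $(J,g)$ of a $(1,1)$-tensor field $J$ and a semi-Riemannian metric $g$ with $J^2=\alpha Id$ and $g(JX,JY)=\varepsilon g(X,Y)$ for all $X,Y\in\mathfrak{X}(M)$; then $(M,J,g)$ is called a $(J^2=\pm1)$-metric manifold. If $\varepsilon=1$, $g$ is Riemannian; if $\varepsilon=-1$, $g$ has signature $(n,n)$ with $\dim M=2n$; if $\alpha=\varepsilon=1$, the trace of $J$ is assumed to vanish (so $\dim M$ is even). The case $\alpha\varepsilon=1$ comprises almost product Riemannian manifolds ($\alpha=\varepsilon=1$) and almost Norden (almost anti-Hermitian) manifolds ($\alpha=\varepsilon=-1$). $(M,J,g)$ is a Kähler type manifold if $\nabla^{\mathrm g}J=0$. *)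

(* Defs.v *)
From HB Require Import structures.
From mathcomp Require Import all_boot all_order all_algebra.
From mathcomp Require Import all_classical all_reals all_analysis.
Set Implicit Arguments.
Unset Strict Implicit.
Unset Printing Implicit Defensive.
Import Order.TTheory GRing.Theory Num.Theory.
Import numFieldNormedType.Exports.
Local Open Scope classical_set_scope.
Local Open Scope ring_scope.

(* [iter_differentiable k U f]: all iterated partial derivatives of [f] of
   order < k exist on U and are (Frechet) differentiable there.  The sets U
   used below are open. *)
Fixpoint iter_differentiable (R : realType) (n : nat) (V : normedModType R)
    (k : nat) (U : set 'rV[R]_n) (f : 'rV[R]_n -> V) : Prop :=
  match k with
  | 0%N => True
  | k'.+1 =>
      (forall x, U x -> differentiable f x) /\
      (forall i : 'I_n,
          iter_differentiable k' U (fun x => 'D_(delta_mx 0 i) f x))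
  end.

Definition smooth_on (R : realType) (n : nat) (V : normedModType R)
    (U : set 'rV[R]_n) (f : 'rV[R]_n -> V) : Prop :=
  forall k, iter_differentiable k U f.

(* Charts are total functions; only their values on [chart_dom], and those of
   the inverse on the image of [chart_dom], are meaningful. *)
Record chart (R : realType) (M : topologicalType) (n : nat) := Chart {
  chart_dom : set M;
  chart_map : M -> 'rV[R]_n;
  chart_inv : 'rV[R]_n -> M;
  chart_dom_open : open chart_dom;
  chart_img_open : open (chart_map @` chart_dom);
  chart_mapK : forall p, chart_dom p -> chart_inv (chart_map p) = p;
  chart_map_continuous : {within chart_dom, continuous chart_map};
  chart_inv_continuous :
    {within chart_map @` chart_dom, continuous chart_inv} }.

Definition chart_img (R : realType) (M : topologicalType) (n : nat)
    (c : chart R M n) : set 'rV[R]_n := chart_map c @` chart_dom c.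

Record smooth_manifold (R : realType) (n : nat) := SmoothManifold {
  carrier :> topologicalType;
  carrier_hausdorff : hausdorff_space carrier;
  carrier_second_countable : @second_countable carrier;
  atlas : set (chart R carrier n);
  atlas_cover : forall p : carrier, exists c, atlas c /\ chart_dom c p;
  atlas_compatible : forall c d, atlas c -> atlas d ->
    smooth_on (chart_map c @` (chart_dom c `&` chart_dom d))
              (chart_map d \o chart_inv c) }.

Section Manifold.
Variables (R : realType) (n : nat) (M : smooth_manifold R n).

(* A chosen chart around p.  The tangent space T_p M is represented by
   'rV[R]_n, as coordinates of tangent vectors in the chart [chart_at p]. *)
Definition chart_at (p : M) : chart R M n := projT1 (cid (atlas_cover p)).

Definition at_coord (p : M) : 'rV[R]_n := chart_map (chart_at p) p.

Definition smooth_fun (f : M -> R) : Prop :=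
  forall c, atlas c -> smooth_on (chart_img c) (f \o chart_inv c).

(* [X p] is a tangent vector at p, in the coordinates of [chart_at p]. *)
Definition tangent_field : Type := M -> 'rV[R]_n.

(* The coordinates of [X p] in a chart c around p: the image of [X p] under
   the differential of the transition map from [chart_at p] to c. *)
Definition local_rep (c : chart R M n) (X : tangent_field) (p : M)
    : 'rV[R]_n :=
  'D_(X p) (chart_map c \o chart_inv (chart_at p)) (at_coord p).

(* X is an element of X(M). *)
Definition vector_field (X : tangent_field) : Prop :=
  forall c, atlas c ->
    smooth_on (chart_img c) (local_rep c X \o chart_inv c).

(* The function X f. *)
Definition deriv_along (X : tangent_field) (f : M -> R) (p : M) : R :=
  'D_(X p) (f \o chart_inv (chart_at p)) (at_coord p).

(* A (1,1)-tensor field J acts on T_p M by the row-vector action v |-> v J_p;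
   a (0,2)-tensor field g is given at p by its Gram matrix.  Both are smooth
   when they send smooth vector fields to smooth objects. *)
Definition tensor_act (J : M -> 'M[R]_n) (X : tangent_field) : tangent_field :=
  fun p => X p *m J p.

Definition tensor11 (J : M -> 'M[R]_n) : Prop :=
  forall X, vector_field X -> vector_field (tensor_act J X).

Definition bilin (g : M -> 'M[R]_n) (X Y : tangent_field) (p : M) : R :=
  (X p *m g p *m (Y p)^T) 0 0.

Definition tensor02 (g : M -> 'M[R]_n) : Prop :=
  forall X Y, vector_field X -> vector_field Y -> smooth_fun (bilin g X Y).

Definition has_signature (r s : nat) (G : 'M[R]_n) : Prop :=
  (r + s)%N = n /\
  exists2 P : 'M[R]_n, P \in unitmx &
    P *m G *m P^T = diag_mx (\row_i (if (i < r)%N then 1 else -1)).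

Definition semi_riemannian_metric (g : M -> 'M[R]_n) : Prop :=
  [/\ tensor02 g, (forall p, (g p)^T = g p) &
      exists r s, forall p, has_signature r s (g p)].

Definition positive_definite (G : 'M[R]_n) : Prop :=
  forall v : 'rV[R]_n, v != 0 -> 0 < (v *m G *m v^T) 0 0.

Record alpha_eps_structure (alpha eps : R) (J g : M -> 'M[R]_n) : Prop :=
  AlphaEpsStructure {
    aes_alpha : alpha = 1 \/ alpha = -1;
    aes_eps : eps = 1 \/ eps = -1;
    aes_J : tensor11 J;
    aes_g : semi_riemannian_metric g;
    aes_sqr : forall p, J p *m J p = alpha%:M;
    aes_compat : forall X Y, vector_field X -> vector_field Y ->
      forall p, bilin g (tensor_act J X) (tensor_act J Y) p
                = eps * bilin g X Y p;
    aes_riemannian : eps = 1 -> forall p, positive_definite (g p);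
    aes_neutral : eps = -1 ->
      exists m, n = (m + m)%N /\ forall p, has_signature m m (g p);
    aes_trace : alpha = 1 -> eps = 1 -> forall p, \tr (J p) = 0 }.

(* A connection is an operation on X(M); its values on arguments that are not
   smooth vector fields are irrelevant. *)
Record connection (nabla : tangent_field -> tangent_field -> tangent_field)
    : Prop := Connection {
  conn_smooth : forall X Y, vector_field X -> vector_field Y ->
    vector_field (nabla X Y);
  conn_addl : forall X X' Y,
    vector_field X -> vector_field X' -> vector_field Y ->
    forall p, nabla (fun q => X q + X' q) Y p = nabla X Y p + nabla X' Y p;
  conn_scalel : forall f X Y,
    smooth_fun f -> vector_field X -> vector_field Y ->
    forall p, nabla (fun q => f q *: X q) Y p = f p *: nabla X Y p;
  conn_addr : forall X Y Y',
    vector_field X -> vector_field Y -> vector_field Y' ->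
    forall p, nabla X (fun q => Y q + Y' q) p = nabla X Y p + nabla X Y' p;
  conn_leibniz : forall f X Y,
    smooth_fun f -> vector_field X -> vector_field Y ->
    forall p, nabla X (fun q => f q *: Y q) p
              = deriv_along X f p *: Y p + f p *: nabla X Y p }.

(* Z is the Lie bracket [X, Y]. *)
Definition is_lie_bracket (X Y Z : tangent_field) : Prop :=
  forall f, smooth_fun f -> forall p,
    deriv_along Z f p = deriv_along X (deriv_along Y f) p
                        - deriv_along Y (deriv_along X f) p.

Definition torsion_free
    (nabla : tangent_field -> tangent_field -> tangent_field) : Prop :=
  forall X Y, vector_field X -> vector_field Y ->
    is_lie_bracket X Y (fun p => nabla X Y p - nabla Y X p).

Definition metric_compatible (g : M -> 'M[R]_n)
    (nabla : tangent_field -> tangent_field -> tangent_field) : Prop :=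
  forall X Y Z, vector_field X -> vector_field Y -> vector_field Z ->
    forall p, deriv_along X (bilin g Y Z) p
              = bilin g (nabla X Y) Z p + bilin g Y (nabla X Z) p.

Definition levi_civita (g : M -> 'M[R]_n)
    (nabla : tangent_field -> tangent_field -> tangent_field) : Prop :=
  [/\ connection nabla, torsion_free nabla & metric_compatible g nabla].

(* (nabla_X J) Y = nabla_X (J Y) - J (nabla_X Y) *)
Definition cov_deriv
    (nabla : tangent_field -> tangent_field -> tangent_field)
    (J : M -> 'M[R]_n) (X Y : tangent_field) : tangent_field :=
  fun p => nabla X (tensor_act J Y) p - tensor_act J (nabla X Y) p.

(* nabla J = 0; with nabla the Levi-Civita connection of g, this says that
   (M, J, g) is a Kahler type manifold. *)
Definition parallel (nabla : tangent_field -> tangent_field -> tangent_field)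
    (J : M -> 'M[R]_n) : Prop :=
  forall X Y, vector_field X -> vector_field Y ->
    forall p, cov_deriv nabla J X Y p = 0.

End Manifold.

(* Main.v *)
Require Import Defs.
From HB Require Import structures.
From mathcomp Require Import all_boot all_order all_algebra.
From mathcomp Require Import all_classical all_reals all_analysis.
From mathcomp Require Import ring lra.
Import Order.TTheory GRing.Theory Num.Theory.
Import numFieldNormedType.Exports.
Local Open Scope classical_set_scope.
Local Open Scope ring_scope.

(** Write g for the metric and put T(X,Y,Z) = g((nabla_X J)Y, Z).  Since
    alpha eps = 1, the relations J^2 = alpha and g(JX,JY) = eps g(X,Y) make J
    self-adjoint for g ([structure_self_adjoint]); as the Levi-Civita connection
    preserves g, each nabla_X J is self-adjoint as well, that is, T is symmetric
    in its last two arguments ([bilin_cov_derivC]).  The hypothesis says that T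
    is skew in its first two arguments.  The two symmetries together force
    T = -T: moving Z to the front, exchanging, and moving back takes three
    transpositions of each kind.  Hence (nabla_X J)Y is g-orthogonal at every
    point to all smooth vector fields.

    To conclude that (nabla_X J)Y vanishes, nondegeneracy of g at p has to be
    tested against smooth vector fields, so every tangent vector at p must be the
    value of a globally defined smooth field ([vector_field_extension]).  Such a
    field is obtained by multiplying a constant field of a chart around p by a
    bump function of the chart, and extending by zero ([bump_field]).  In another
    chart d it reads (bump o tau) D_v(d o c^-1) o tau, with tau the transition
    map from d to c, so its smoothness rests on the stability of iterated
    differentiability under sums, products and composition, and on
    the smoothness of the bump function; near the points outside the chart it is
    zero because its support is the image of a compact ball, which is closed as
    the manifold is Hausdorff.  The bump function is e^(-1/t), extended by zero
    to t <= 0, taken at t = r^2 - |x - a|^2. *)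

Set Implicit Arguments.
Unset Strict Implicit.

(** * Calculus of iterated differentiability *)

(** Differentiability at a point is a property of germs: the first-order
    expansion of f at a serves for g as well. *)
Lemma near_eq_is_diff (R : numFieldType) (V W : normedModType R)
    (f g : V -> W) (a : V) :
  (\near a, f a = g a) -> differentiable f a -> differentiable g a.
Proof.
move=> fg df.
have dg : g \o shift a = cst (g a) + 'd f a +o_ 0 id.
  apply/eqaddoP => e e0.
  have /diff_locally/eqaddoP/(_ e e0) := df.
  apply: filter_app.
  have : \forall h \near 0, f (h + a) = g (h + a).
    by move: fg; rewrite (near_shift 0 a) /= subr0.
  apply: filter_app; near=> h => fgh.
  by rewrite !fctE /= fgh (nbhs_singleton fg).
apply/diff_locallyP; split.
  have -> : 'd g a = 'd f a :> (V -> W).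
    by apply: diff_unique => //; exact: diff_continuous.
  exact: diff_continuous.
have -> : 'd g a = 'd f a :> (V -> W).
  by apply: diff_unique => //; exact: diff_continuous.
exact: dg.
Unshelve. all: by end_near. Qed.

Section IteratedDifferentiability.
Context (R : realType) (n : nat).
Local Notation E := 'rV[R]_n.
Implicit Types (U : set E) (k : nat).

Lemma iter_differentiableS {V : normedModType R} k U (f : E -> V) :
  iter_differentiable k.+1 U f -> iter_differentiable k U f.
Proof.
elim: k f => [//|k IH] f [df Df]; split=> // i.
exact: IH (Df i).
Qed.

(** Smoothness may be checked with a different formula for f on each piece of
    a cover. *)
Lemma iter_differentiable_local {V : normedModType R} k U (f : E -> V) :
  (forall x, U x -> exists2 U', U' x & iter_differentiable k U' f) ->
  iter_differentiable k U f.
Proof.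
elim: k f => [//|k IH] f loc; split=> [x /loc[U' U'x [+ _]]|i].
  exact.
by apply: IH => x /loc[U' U'x [_ /(_ i)]]; exists U'.
Qed.

Lemma iter_differentiable_ext {V : normedModType R} k U (f g : E -> V) :
  open U -> {in U, f =1 g} ->
  iter_differentiable k U f -> iter_differentiable k U g.
Proof.
move=> oU; elim: k f g => [//|k IH] f g fg [df Df].
have fgn x : U x -> \near x, f x = g x.
  move=> Ux; near=> y; apply: fg; rewrite inE; near: y.
  exact: open_nbhs_nbhs.
split=> [x Ux|i]; first by apply: near_eq_is_diff (fgn x Ux) (df x Ux).
apply: IH (Df i) => x; rewrite inE => Ux.
exact/near_eq_derive/fgn.
Unshelve. all: by end_near. Qed.

(** Introduction rule: it is enough to recognise the partial derivatives
    on U, where the calculus rules that compute them are valid. *)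
Lemma iter_differentiable_intro {V : normedModType R} k U (f : E -> V)
    (Df : 'I_n -> E -> V) : open U ->
  (forall x, U x -> differentiable f x) ->
  (forall i x, U x -> 'D_(delta_mx 0 i) f x = Df i x) ->
  (forall i, iter_differentiable k U (Df i)) ->
  iter_differentiable k.+1 U f.
Proof.
move=> oU df DfE itDf; split=> // i.
by apply: iter_differentiable_ext (itDf i) => // x; rewrite inE => /DfE ->.
Qed.

Lemma iter_differentiable_cst {V : normedModType R} k U (a : V) :
  iter_differentiable k U (fun _ => a).
Proof.
elim: k a => [//|k IH] a; split=> [x _|i]; first exact: differentiable_cst.
by under eq_fun do rewrite derive_cst; exact: IH.
Qed.

Lemma iter_differentiableD {V : normedModType R} k U (f g : E -> V) : open U ->
  iter_differentiable k U f -> iter_differentiable k U g ->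
  iter_differentiable k U (fun x => f x + g x).
Proof.
move=> oU; elim: k f g => [//|k IH] f g [df Df] [dg Dg].
apply: (@iter_differentiable_intro _ k U _
  (fun i x => 'D_(delta_mx 0 i) f x + 'D_(delta_mx 0 i) g x)) => //.
- by move=> x Ux; apply: differentiableD; [exact: df|exact: dg].
- by move=> i x Ux; apply: deriveD; apply: diff_derivable; [exact: df|exact: dg].
- by move=> i; exact: IH (Df i) (Dg i).
Qed.

Lemma iter_differentiable_sum {V : normedModType R} k U m
    (f : 'I_m -> E -> V) : open U ->
  (forall j, iter_differentiable k U (f j)) ->
  iter_differentiable k U (fun x => \sum_(j < m) f j x).
Proof.
move=> oU; elim: m f => [|m IH] f df.
  by under eq_fun do rewrite big_ord0; exact: iter_differentiable_cst.
under eq_fun do rewrite big_ord_recr /=.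
by apply: iter_differentiableD => //; exact: IH.
Qed.

Lemma iter_differentiableM k U (f g : E -> R) : open U ->
  iter_differentiable k U f -> iter_differentiable k U g ->
  iter_differentiable k U (fun x => f x * g x).
Proof.
move=> oU; elim: k f g => [//|k IH] f g df dg.
have [fd Df] := df; have [gd Dg] := dg.
apply: (@iter_differentiable_intro _ k U _
  (fun i x => f x * 'D_(delta_mx 0 i) g x + g x * 'D_(delta_mx 0 i) f x)) => //.
- by move=> x Ux; apply: differentiableM; [exact: fd|exact: gd].
- by move=> i x Ux; apply: deriveM; apply: diff_derivable; [exact: fd|exact: gd].
- by move=> i; apply: iter_differentiableD => //; apply: IH;
    [exact: iter_differentiableS df|exact: Dg|
     exact: iter_differentiableS dg|exact: Df].
Qed.

Lemma iter_differentiableZl {V : normedModType R} k U (f : E -> R) (w : V) :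
  open U -> iter_differentiable k U f ->
  iter_differentiable k U (fun x => f x *: w).
Proof.
move=> oU; elim: k f => [//|k IH] f [df Df].
apply: (@iter_differentiable_intro _ k U _
  (fun i x => 'D_(delta_mx 0 i) f x *: w)) => //.
- by move=> x Ux; apply/differentiableZl/df.
- move=> i x Ux; rewrite !deriveE//; [|exact: df|exact/differentiableZl/df].
  by rewrite diffZl//; exact: df.
- by move=> i; exact: IH (Df i).
Qed.

Lemma iter_differentiable_coord k U m (f : E -> 'rV[R]_m) (j : 'I_m) : open U ->
  iter_differentiable k U f -> iter_differentiable k U (fun x => f x 0 j).
Proof.
move=> oU; elim: k f => [//|k IH] f [df Df].
apply: (@iter_differentiable_intro _ k U _
  (fun i x => 'D_(delta_mx 0 i) f x 0 j)) => //.
- move=> x Ux; apply: (@differentiable_comp _ _ _ _ f (fun N => N 0 j)).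
    exact: df.
  exact: differentiable_coord.
- move=> i x Ux; rewrite derive_mx ?mxE//.
  exact/diff_derivable/df.
- by move=> i; exact: IH (Df i).
Qed.

Lemma iter_differentiable_rV k U m (f : E -> 'rV[R]_m) : open U ->
  (forall j, iter_differentiable k U (fun x => f x 0 j)) ->
  iter_differentiable k U f.
Proof.
move=> oU df.
have -> : f = (fun x => \sum_(j < m) f x 0 j *: delta_mx 0 j).
  by apply/funext => x; exact: row_sum_delta.
by apply: iter_differentiable_sum => // j; exact: iter_differentiableZl.
Qed.

End IteratedDifferentiability.

Lemma derive_row_sum (R : realType) (m : nat) (V : normedModType R)
    (f : 'rV[R]_m -> V) x v : differentiable f x ->
  'D_v f x = \sum_(j < m) v 0 j *: 'D_(delta_mx 0 j) f x.
Proof.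
move=> df; rewrite deriveE// {1}(row_sum_delta v) linear_sum/=.
by apply: eq_bigr => j _; rewrite linearZ/= deriveE.
Qed.

Lemma derive_comp (R : numFieldType) (U V W : normedModType R)
    (f : U -> V) (h : V -> W) (x v : U) :
  differentiable f x -> differentiable h (f x) ->
  'D_v (h \o f) x = 'D_('D_v f x) h (f x).
Proof.
move=> df dh; rewrite !deriveE//; last exact: differentiable_comp.
by rewrite diff_comp.
Qed.

(** By the chain rule D_i (f o tau) = sum_j (D_i tau)_j ((D_j f) o tau), and
    the induction hypothesis applies to (D_j f) o tau. *)
Lemma iter_differentiable_comp (R : realType) (n m k : nat)
    (U : set 'rV[R]_n) (U' : set 'rV[R]_m) (tau : 'rV[R]_n -> 'rV[R]_m)
    (f : 'rV[R]_m -> R) :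
  open U -> (forall x, U x -> U' (tau x)) ->
  iter_differentiable k U tau -> iter_differentiable k U' f ->
  iter_differentiable k U (f \o tau).
Proof.
move=> oU UU'; elim: k f => [//|k IH] f dtau [df Df].
have [taud Dtau] := dtau.
apply: (@iter_differentiable_intro _ _ _ k U _ (fun i x => \sum_(j < m)
    ('D_(delta_mx 0 i) tau x) 0 j * 'D_(delta_mx 0 j) f (tau x))) => //.
- by move=> x Ux; apply: differentiable_comp; [exact: taud|exact/df/UU'].
- move=> i x Ux; have dfx := df _ (UU' _ Ux).
  by rewrite derive_comp//; [exact: derive_row_sum|exact: taud].
- move=> i; apply: iter_differentiable_sum => // j.
  apply: iter_differentiableM => //.
    exact/iter_differentiable_coord/Dtau.
  exact: IH (iter_differentiableS dtau) (Df j).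
Qed.

(** * A flat function *)

(** The family t^-m e^(-1/t), extended by zero: unlike e^(-1/t) alone, its
    linear span is closed under differentiation, so that smoothness is a plain
    induction ([iter_differentiable_flat_exp]). *)
Definition flat_exp (R : realType) (m : nat) (t : R) : R :=
  if 0 < t then t^-1 ^+ m * expR (- t^-1) else 0.

Lemma flat_exp_ge0 (R : realType) m (t : R) : 0 <= flat_exp m t.
Proof.
rewrite /flat_exp; case: ifPn => // t0.
by rewrite mulr_ge0 ?expR_ge0// exprn_ge0// invr_ge0 ltW.
Qed.

(** From e^s >= s^(m+2) / (m+2)! at s = 1/t.  The quadratic bound makes every
    member of the family continuous at 0. *)
Lemma flat_exp_le (R : realType) m (t : R) :
  flat_exp m t <= (m.+2)`!%:R * t ^+ 2.
Proof.
rewrite /flat_exp; case: ifPn => [t0|_]; last first.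
  by rewrite mulr_ge0// sqr_ge0.
have ti0 : 0 < t^-1 by rewrite invr_gt0.
rewrite expRN ler_pdivrMr ?expR_gt0//.
have := @expR_ge1Dxn R t^-1 m.+1 (ltW ti0) => h.
have {}h : t^-1 ^+ m.+2 / (m.+2)`!%:R <= expR t^-1.
  by rewrite (le_trans _ h)// lerDr.
have f0 : 0 < (m.+2)`!%:R :> R by rewrite ltr0n fact_gt0.
rewrite ler_pdivrMr// in h.
apply: (@le_trans _ _ (t^-1 ^+ m.+2 * t ^+ 2)).
  rewrite -addn2 exprD -mulrA -exprMn mulVf ?gt_eqF// expr1n mulr1//.
by rewrite [leRHS]mulrAC ler_wpM2r ?sqr_ge0// mulrC.
Qed.

Lemma continuous_flat_exp0 (R : realType) m : {for 0, continuous (@flat_exp R m)}.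
Proof.
rewrite /prop_for /continuous_at {2}/flat_exp ltxx.
apply: (@squeeze_cvgr _ _ _ _ (cst 0) (fun t => (m.+2)`!%:R * t ^+ 2)).
- by near=> t; rewrite flat_exp_ge0 flat_exp_le.
- exact: cvg_cst.
- rewrite -[X in _ --> X](_ : (m.+2)`!%:R * 0 ^+ 2 = 0); last first.
    by rewrite expr0n mulr0.
  by apply: cvgM; [exact: cvg_cst|exact: exprn_continuous].
Unshelve. all: by end_near. Qed.

Lemma is_derive_flat_exp (R : realType) m (t : R) :
  is_derive t 1 (flat_exp m)
    (flat_exp m.+2 t - m%:R * flat_exp m.+1 t).
Proof.
have [t0|t0|->] := ltgtP t 0.
- have E k : flat_exp k t = 0 by rewrite /flat_exp lt_gtF.
  rewrite !E mulr0 subr0.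
  apply: (@near_eq_is_derive _ _ _ (cst 0)).
  near=> s; rewrite /flat_exp lt_gtF//; near: s; exact: lt_nbhsl.
- have tn0 : t != 0 by rewrite gt_eqF.
  apply: (@near_eq_is_derive _ _ _ (fun t : R => t^-1 ^+ m * expR (- t^-1))).
    by near=> s; rewrite /flat_exp ifT//; near: s; exact: lt_nbhsr.
  have di : is_derive t 1 (fun s : R => s^-1) (- (t ^- 2)).
    by have := is_deriveV tn0 (is_derive_id t 1); rewrite /GRing.scale /= mulr1.
  have dX := @is_deriveX _ _ _ m _ _ _ di.
  rewrite exprfctE in dX.
  have dE := @is_derive1_comp _ expR (fun s : R => - s^-1) t _ _
    (is_derive_expR (- t^-1)) (is_deriveN di).
  apply: (is_derive_eq (is_deriveM dX dE)).
  rewrite /flat_exp t0 /GRing.scale /= opprK -exprVn.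
  case: m {dX} => [|m]; rewrite ?fctE /= ?expr0 ?mul0r ?exprSr; ring.
- have E k : flat_exp k 0 = 0 :> R by rewrite /flat_exp ltxx.
  rewrite !E mulr0 subr0; apply/is_derive1_caratheodory.
  (* By Caratheodory's criterion, as t^-m e^(-1/t) = t (t^-(m+1) e^(-1/t)). *)
  exists (flat_exp m.+1); split; [move=> z|exact: continuous_flat_exp0|exact: E].
  rewrite E !subr0 /flat_exp; case: ifPn => [z0|_]; last by rewrite mul0r.
  by rewrite exprSr mulrAC -(mulrA _ z^-1) mulVf ?gt_eqF// mulr1.
Unshelve. all: by end_near. Qed.

Lemma iter_differentiable_flat_exp (R : realType) n (k m : nat)
    (U : set 'rV[R]_n) (q : 'rV[R]_n -> R) :
  open U -> iter_differentiable k U q ->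
  iter_differentiable k U (fun x => flat_exp m (q x)).
Proof.
move=> oU; elim: k m => [//|k IH] m dq; have [qd Dq] := dq.
have fd t : differentiable (@flat_exp R m) t.
  exact/derivable1_diffP/(@ex_derive _ _ _ _ _ _ _ (is_derive_flat_exp m t)).
apply: (@iter_differentiable_intro _ _ _ k U _ (fun i x =>
  'D_(delta_mx 0 i) q x *
  (flat_exp m.+2 (q x) + (- m%:R) * flat_exp m.+1 (q x)))) => //.
- by move=> x Ux; apply: (@differentiable_comp _ _ _ _ q (flat_exp m)) => //;
    exact: qd.
- move=> i x Ux; have /= -> := @derive_comp _ _ _ _ q (flat_exp m) x
    (delta_mx 0 i) (qd _ Ux) (fd _).
  rewrite [LHS]deriveE// -[X in 'd _ _ X]mulr1 [LHS]linearZ/= -deriveE//.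
  by rewrite (@derive_val _ _ _ _ _ _ _ (is_derive_flat_exp m _)) mulNr.
- move=> i; have dq' := iter_differentiableS dq.
  apply: iter_differentiableM => //; first exact: Dq.
  apply: iter_differentiableD => //; first exact: IH.
  apply: iter_differentiableM => //; last exact: IH.
  exact: iter_differentiable_cst.
Qed.

(** * Bump functions *)

Definition bump_fun (R : realType) n (a : 'rV[R]_n) (r : R) (x : 'rV[R]_n) : R :=
  flat_exp 0 (r ^+ 2 - \sum_(j < n) (x 0 j - a 0 j) ^+ 2).

Lemma smooth_bump (R : realType) n (U : set 'rV[R]_n) (a : 'rV[R]_n) (r : R) :
  open U -> smooth_on U (bump_fun a r).
Proof.
move=> oU k; apply: iter_differentiable_flat_exp => //.
have did : iter_differentiable k U (fun x : 'rV[R]_n => x).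
  case: k => [//|k]; split=> [x _|i]; first exact: ex_diff.
  by under eq_fun do rewrite derive_id; exact: iter_differentiable_cst.
apply: (@iter_differentiable_ext _ _ _ k U
  (fun x => r ^+ 2 + \sum_(j < n) (-1) * ((x 0 j + - a 0 j) * (x 0 j + - a 0 j)))) => //.
  move=> x _; congr (_ + _); rewrite -sumrN; apply: eq_bigr => j _.
  by rewrite mulN1r expr2.
apply: iter_differentiableD => //; first exact: iter_differentiable_cst.
apply: iter_differentiable_sum => // j.
apply: iter_differentiableM => //; first exact: iter_differentiable_cst.
by apply: iter_differentiableM => //; apply: iter_differentiableD => //;
  [exact: iter_differentiable_coord|exact: iter_differentiable_cst
  |exact: iter_differentiable_coord|exact: iter_differentiable_cst].
Qed.

Lemma bump_center (R : realType) n (a : 'rV[R]_n) (r : R) :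
  0 < r -> 0 < bump_fun a r a.
Proof.
move=> r0; rewrite /bump_fun big1 ?subr0 => [|j _]; last by rewrite subrr expr0n.
by rewrite /flat_exp exprn_gt0// expr0 mul1r expR_gt0.
Qed.

(** The norm on row vectors is the maximum norm, hence bounded by the Euclidean
    norm that occurs in the bump function. *)
Lemma bump_support (R : realType) n (a : 'rV[R]_n) (r : R) x :
  0 < r -> bump_fun a r x != 0 -> closed_ball a r x.
Proof.
move=> r0; rewrite /bump_fun /flat_exp; case: ifPn; last by rewrite eqxx.
rewrite subr_gt0 => lt_r _; rewrite closed_ballE// /closed_ball_ /=.
rewrite [leLHS]mx_normrE; apply: bigmax_le => [|[i j] _]; first exact: ltW.
rewrite (ord1 i) !mxE /= distrC -ler_sqr ?nnegrE ?(ltW r0)// real_normK ?num_real//.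
apply: le_trans (ltW lt_r); rewrite (bigD1 j)//= lerDl.
by apply: sumr_ge0 => l _; exact: sqr_ge0.
Qed.

(** * Smooth vector fields with a prescribed value *)

Lemma chart_open_image (R : realType) (M : topologicalType) n
    (c : chart R M n) (O : set M) :
  open O -> open (chart_map c @` (chart_dom c `&` O)).
Proof.
move=> oO.
have -> : chart_map c @` (chart_dom c `&` O) =
    chart_map c @` chart_dom c `&` chart_inv c @^-1` O.
  apply/seteqP; split=> [_ [p [cp Op] <-]|_ [[p cp <-] Op]].
    by split; [exists p|rewrite /= chart_mapK].
  by exists p => //; split=> //; rewrite /= chart_mapK in Op.
have := @chart_inv_continuous _ _ _ c.
rewrite continuous_open_subspace; last exact: chart_img_open.
by move=> ci; exact: ((continuous_inP _ (@chart_img_open _ _ _ c)).1 ci _ oO).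
Qed.

Section BumpField.
Context (R : realType) (n : nat) (M : smooth_manifold R n).
Implicit Types (c d e : chart R M n) (p q : M) (v : 'rV[R]_n).

Lemma atlas_chart_at p : atlas (chart_at p).
Proof. by rewrite /chart_at; case: cid => c []. Qed.

Lemma chart_dom_chart_at p : chart_dom (chart_at p) p.
Proof. by rewrite /chart_at; case: cid => c []. Qed.

Lemma differentiable_transition c d p : atlas c -> atlas d ->
  chart_dom c p -> chart_dom d p ->
  differentiable (chart_map d \o chart_inv c) (chart_map c p).
Proof.
move=> Ac Ad cp dp; have [+ _] := atlas_compatible Ac Ad 1%N; apply.
by exists p.
Qed.

(** Tangent vectors transform consistently: passing from chart c to d through
    e is the same as passing directly. *)
Lemma derive_transition_comp c d e p v : atlas c -> atlas d -> atlas e ->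
  chart_dom c p -> chart_dom d p -> chart_dom e p ->
  'D_('D_v (chart_map e \o chart_inv c) (chart_map c p))
     (chart_map d \o chart_inv e) (chart_map e p)
  = 'D_v (chart_map d \o chart_inv c) (chart_map c p).
Proof.
move=> Ac Ad Ae cp dp ep.
have tE : (chart_map e \o chart_inv c) (chart_map c p) = chart_map e p.
  by rewrite /= chart_mapK.
rewrite -tE -derive_comp ?tE; [|exact: differentiable_transition..].
apply: near_eq_derive; near=> y.
have : (chart_map c @` (chart_dom c `&` chart_dom e)) y.
  near: y; apply: open_nbhs_nbhs; split; last by exists p.
  exact/chart_open_image/chart_dom_open.
by move=> [q [cq eq] <-] /=; rewrite !chart_mapK.
Unshelve. all: by end_near. Qed.

(** The constant field v of the chart c, cut off by a bump function.  At q it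
    has to be expressed in the chart chosen at q, hence the differential of the
    transition map. *)
Definition bump_field c (a : 'rV[R]_n) (r : R) v : tangent_field M :=
  fun q => if q \in chart_dom c then
    bump_fun a r (chart_map c q) *:
      'D_v (chart_map (chart_at q) \o chart_inv c) (chart_map c q)
  else 0.

Lemma local_rep_bump_field c d a r v q : atlas c -> atlas d ->
  chart_dom c q -> chart_dom d q ->
  local_rep d (bump_field c a r v) q =
  bump_fun a r (chart_map c q) *:
    'D_v (chart_map d \o chart_inv c) (chart_map c q).
Proof.
move=> Ac Ad cq dq; have Aq := atlas_chart_at q; have qq := chart_dom_chart_at q.
have df := differentiable_transition Aq Ad qq dq.
rewrite /local_rep /bump_field mem_set// deriveE// linearZ/= -deriveE//.
by rewrite derive_transition_comp.
Qed.

(** The images under d of the domain of c and of the complement of the support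
    K cover the image of d; both are open, K being compact in a Hausdorff
    space.  On the first the field has an explicit smooth expression, on the
    second it vanishes. *)
Lemma vector_field_bump_field c a r v : atlas c -> 0 < r ->
  closed_ball a r `<=` chart_img c -> vector_field (bump_field c a r v).
Proof.
move=> Ac r0 ac d Ad k.
pose K := chart_inv c @` closed_ball a r.
have clK : closed K.
  apply: compact_closed; first exact: carrier_hausdorff.
  apply: continuous_compact.
    exact: continuous_subspaceW ac (@chart_inv_continuous _ _ _ c).
  apply: bounded_closed_compact; last exact: closed_ball_closed.
  exists (`|a| + r); split=> [|B ltB y]; first exact: num_real.
  rewrite closed_ballE// /closed_ball_ /= => yr; apply: ltW.
  rewrite (le_lt_trans _ ltB)// -(subKr a y) (le_trans (ler_normB _ _))//.
  by rewrite lerD2l.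
apply: iter_differentiable_local => _ [p dp <-].
have [cp|Ncp] := pselect (chart_dom c p).
- pose U := chart_map d @` (chart_dom d `&` chart_dom c).
  have oU : open U by exact/chart_open_image/chart_dom_open.
  exists U; first by exists p.
  pose W := chart_map c @` (chart_dom c `&` chart_dom d).
  have oW : open W by exact/chart_open_image/chart_dom_open.
  pose tau := chart_map c \o chart_inv d.
  pose h := chart_map d \o chart_inv c.
  have UW x : U x -> W (tau x).
    by move=> [q [dq cq] <-]; exists q => //; rewrite /tau /= chart_mapK.
  have dtau : iter_differentiable k U tau by exact: atlas_compatible.
  have [hd Dh] : iter_differentiable k.+1 W h by exact: atlas_compatible.
  apply: iter_differentiable_rV => // j.
  apply: (@iter_differentiable_ext _ _ _ k U (fun x => bump_fun a r (tau x) *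
    \sum_(i < n) v 0 i * 'D_(delta_mx 0 i) h (tau x) 0 j)) => //.
    move=> _ /[!inE] -[q [dq cq] <-]; rewrite /tau /= chart_mapK//.
    rewrite local_rep_bump_field// mxE; congr (_ * _).
    rewrite derive_row_sum; last by apply: hd; exists q.
    by rewrite summxE; apply: eq_bigr => i _; rewrite mxE.
  apply: iter_differentiableM => //.
    exact: iter_differentiable_comp UW dtau (smooth_bump a r oW k).
  apply: iter_differentiable_sum => // i.
  apply: iter_differentiableM => //; first exact: iter_differentiable_cst.
  apply: (iter_differentiable_comp oU UW dtau
    (f := fun y => 'D_(delta_mx 0 i) h y 0 j)).
  exact: iter_differentiable_coord (Dh i).
- pose U := chart_map d @` (chart_dom d `&` ~` K).
  have oU : open U by apply: chart_open_image; exact: closed_openC.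
  exists U.
    exists p => //; split=> // -[y /ac[q cq <-]]; rewrite chart_mapK// => qp.
    by apply: Ncp; rewrite -qp.
  apply: (@iter_differentiable_ext _ _ _ k U (fun _ => 0)) => //.
    move=> _ /[!inE] -[q [dq Kq] <-]; rewrite /= chart_mapK// /local_rep.
    suff -> : bump_field c a r v q = 0 by rewrite derive0.
    rewrite /bump_field; case: ifPn => // /set_mem cq.
    have [->|/(bump_support r0) aq] := eqVneq (bump_fun a r (chart_map c q)) 0.
      by rewrite scale0r.
    by exfalso; apply: Kq; exists (chart_map c q) => //; exact: chart_mapK.
  exact: iter_differentiable_cst.
Qed.

Lemma vector_field_extension p v : exists2 Z, vector_field Z & Z p = v.
Proof.
pose c := chart_at p; pose a := chart_map c p.
have Ac : atlas c := atlas_chart_at p.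
have cp : chart_dom c p := chart_dom_chart_at p.
have [r /= r0 ac] : exists2 r : R, 0 < r & closed_ball a r `<=` chart_img c.
  have /nbhs_closedballP[r ?] : nbhs a (chart_img c).
    by apply: open_nbhs_nbhs; split; [exact: chart_img_open|exists p].
  by exists r%:num.
have b0 := bump_center a r0.
(* Dividing by the height of the bump at its centre makes the value v. *)
exists (bump_field c a r ((bump_fun a r a)^-1 *: v)).
  exact: vector_field_bump_field.
rewrite /bump_field mem_set// -/c -/a (near_eq_derive _ (g := id)).
  by rewrite derive_id scalerA divff ?gt_eqF// scale1r.
near=> y.
have : chart_img c y.
  near: y; apply: open_nbhs_nbhs; split; [exact: chart_img_open|by exists p].
by move=> [q cq <-] /=; rewrite chart_mapK.
Unshelve. all: by end_near. Qed.

End BumpField.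

(** * Nondegeneracy of the metric *)

Section Bilinear.
Context (R : realType) (n : nat) (M : smooth_manifold R n).
Implicit Types (g : M -> 'M[R]_n) (X Y Z : tangent_field M) (p : M).

Lemma bilinC g X Y p : (g p)^T = g p -> bilin g X Y p = bilin g Y X p.
Proof.
move=> gT; transitivity ((X p *m g p *m (Y p)^T)^T 0 0); first by rewrite mxE.
by rewrite !trmx_mul trmxK gT mulmxA.
Qed.

Lemma bilinBl g X Y Z p :
  bilin g (fun q => X q - Y q) Z p = bilin g X Z p - bilin g Y Z p.
Proof. by rewrite /bilin !mulmxBl !mxE. Qed.

Lemma bilinNl g X Y p : bilin g (fun q => - X q) Y p = - bilin g X Y p.
Proof. by rewrite /bilin !mulNmx mxE. Qed.

Lemma has_signature_unitmx r s (G : 'M[R]_n) : has_signature r s G -> G \in unitmx.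
Proof.
move=> [_ [P uP PGP]].
have : P *m G *m P^T \in unitmx.
  rewrite PGP unitmxE det_diag unitfE; apply/prodf_neq0 => i _.
  by rewrite mxE; case: ifP; rewrite ?oppr_eq0 oner_eq0.
by rewrite !unitmx_mul unitmx_tr uP /= andbT.
Qed.

(** Pointwise nondegeneracy tested on smooth fields: each basis vector at p
    extends to one. *)
Lemma bilin_nondegenerate g X p : g p \in unitmx ->
  (forall Z, vector_field Z -> bilin g X Z p = 0) -> X p = 0.
Proof.
move=> ug XZ0; suff Xg0 : X p *m g p = 0.
  by rewrite -[X p](mulmxK ug) Xg0 mul0mx.
apply/rowP => j; rewrite [RHS]mxE.
have [Z vZ Zp] := vector_field_extension p (delta_mx 0 j).
have := XZ0 Z vZ; rewrite /bilin Zp trmx_delta => <-.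
by rewrite -colE [RHS]mxE.
Qed.

End Bilinear.

(** * Self-adjointness of J and of its covariant derivative *)

Section CovariantDerivative.
Context (R : realType) (n : nat) (M : smooth_manifold R n).
Context (J g : M -> 'M[R]_n).
Implicit Types X Y Z : tangent_field M.

(** eps g(X,JY) = g(JX,J^2 Y) = alpha g(JX,Y), and alpha eps = 1 with both signs
    means alpha = eps. *)
Lemma structure_self_adjoint (alpha eps : R) X Y p :
  alpha_eps_structure alpha eps J g -> alpha * eps = 1 ->
  vector_field X -> vector_field Y ->
  bilin g (tensor_act J X) Y p = bilin g X (tensor_act J Y) p.
Proof.
move=> aes ae1 vX vY.
have := aes_compat aes vX (aes_J aes vY) p.
have -> : bilin g (tensor_act J X) (tensor_act J (tensor_act J Y)) p =
    alpha * bilin g (tensor_act J X) Y p.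
  have JJY : tensor_act J (tensor_act J Y) p = alpha *: Y p.
    by rewrite /tensor_act -mulmxA (aes_sqr aes) mul_mx_scalar.
  by rewrite /bilin JJY linearZ/= -scalemxAr mxE.
have alpha0 : alpha != 0.
  by apply/eqP => a0; move/eqP: ae1; rewrite a0 mul0r eq_sym oner_eq0.
have -> : eps = alpha.
  by move: ae1; case: (aes_alpha aes) => ->;
    rewrite ?mul1r// mulN1r => <-; rewrite opprK.
exact: mulfI.
Qed.

(** Differentiate g(JY,Z) = g(Y,JZ) along X and expand both sides by metric
    compatibility. *)
Lemma bilin_cov_derivC nabla X Y Z p :
  levi_civita g nabla -> tensor11 J -> (g p)^T = g p ->
  (forall X Y p, vector_field X -> vector_field Y ->
     bilin g (tensor_act J X) Y p = bilin g X (tensor_act J Y) p) ->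
  vector_field X -> vector_field Y -> vector_field Z ->
  bilin g (cov_deriv nabla J X Y) Z p = bilin g (cov_deriv nabla J X Z) Y p.
Proof.
move=> [nablaC _ nablag] JJ gT sJ vX vY vZ.
have vnY := conn_smooth nablaC vX vY; have vnZ := conn_smooth nablaC vX vZ.
have E : bilin g (tensor_act J Y) Z = bilin g Y (tensor_act J Z).
  by apply/funext => q; exact: sJ.
have := nablag _ _ _ vX (JJ _ vY) vZ p.
rewrite E nablag//; last exact: JJ.
rewrite /cov_deriv !bilinBl !sJ// => H.
rewrite (bilinC (nabla X (tensor_act J Z)))// (bilinC (nabla X Z))// sJ//.
by lra.
Qed.

End CovariantDerivative.

Unset Implicit Arguments.

Theorem theorem4p1 (R : realType) (n : nat) (M : smooth_manifold R n)
    (alpha eps : R) (J g : M -> 'M[R]_n)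
    (nabla : tangent_field M -> tangent_field M -> tangent_field M) :
  alpha_eps_structure alpha eps J g ->
  alpha * eps = 1 ->
  levi_civita g nabla ->
  (forall X Y : tangent_field M, vector_field X -> vector_field Y ->
     forall p : M,
       cov_deriv nabla J X Y p + cov_deriv nabla J Y X p = 0) ->
  parallel nabla J.
Proof.
move=> aes ae1 LC skew X Y vX vY p.
have [_ gT [r [s sg]]] := aes_g aes.
pose T A B C := bilin g (cov_deriv nabla J A B) C p.
have Tsym A B C : vector_field A -> vector_field B -> vector_field C ->
    T A B C = T A C B.
  move=> vA vB vC; apply: (bilin_cov_derivC LC) => //; first exact: aes_J aes.
  by move=> *; exact: structure_self_adjoint aes ae1 _ _.
have Tskew A B C : vector_field A -> vector_field B -> T A B C = - T B A C.
  move=> vA vB; rewrite /T -bilinNl /bilin; congr ((_ *m _ *m _) 0 0).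
  by apply/eqP; rewrite -addr_eq0 skew.
apply: (@bilin_nondegenerate _ _ _ g) => [|Z vZ].
  exact: has_signature_unitmx (sg p).
have h : T X Y Z = - T X Y Z.
  (* XYZ -> XZY -> ZXY -> ZYX -> YZX -> YXZ -> XYZ, with three sign changes. *)
  rewrite {1}(Tsym X Y Z)// (Tskew X Z Y)// (Tsym Z X Y)// (Tskew Z Y X)//.
  by rewrite opprK (Tsym Y Z X)// (Tskew Y X Z).
by move: h; rewrite /T; lra.
Qed.
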